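(* Let $s,t\in\mathbb R$ with $s>t$, and let $\{a_N\}_{N\in\mathbb N}$ be a sequence in $A_\theta^\infty$. Suppose that there is a constant $C$ such that $\|a_N\|_s\le C$ for all $N$. Then there is a subsequence $\{a_{N_j}\}$ that converges in $H^t$.
   Context: Let $n$ be a positive integer and fix a real skew-symmetric $n\times n$ matrix $\theta$ whose entries above the diagonal are irrational and linearly independent over $\mathbb Q$. $A_\theta$ is the universal $C^*$-algebra generated by unitaries $U_1,\dots,U_n$ with $U_kU_j=e^{2\pi i\theta_{j,k}}U_jU_k$. For $m\in\mathbb Z^n$ write $U^m=U_1^{m_1}\cdots U_n^{m_n}$. $\{\alpha_s\}_{s\in\mathbb R^n}$ is the $n$-parameter group of automorphisms of $A_\theta$ with $\alpha_s(U^m)=e^{is\cdot m}U^m$. $A_\theta^\infty$ is the subalgebra of those $a\in A_\theta$ for which $s\mapsto\alpha_s(a)$ is smooth from $\mathbb R^n$ to $A_\theta$; equivalently $a=\sum_m a_mU^m$ with $(a_m)_{m\in\mathbb Z^n}$ rapidly decreasing. For $s\in\mathbb R$ the Sobolev norm on $A_\theta^\infty$ is $\|a\|_s^2=\sum_{m\in\mathbb Z^n}(1+|m_1|^2+\cdots+|m_n|^2)^s|a_m|^2$ for $a=\sum_m a_mU^m$, and the Sobolev space $H^s$ is the completion of $A_\theta^\infty$ with respect to $\|\cdot\|_s$. *)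

(* Defs.v *)
From HB Require Import structures.
From mathcomp Require Import all_boot all_order all_algebra.
From mathcomp Require Import finmap complex.
From mathcomp Require Import all_classical all_reals all_analysis.
From mathcomp Require Import analysis.showcase.summability.

Set Implicit Arguments.
Unset Strict Implicit.
Unset Printing Implicit Defensive.

Import Order.TTheory GRing.Theory Num.Theory.
Import numFieldNormedType.Exports.

Local Open Scope classical_set_scope.
Local Open Scope ring_scope.
Local Open Scope complex_scope.

(* Unital C*-algebras over R[i].  The ring operations are fields of the mixin
   because the library has no structure joining rings and normed modules.  The
   norm of a normed R[i]-module is R[i]-valued,
   with real nonnegative values; [cnorm_star] is the C*-identity. *)
HB.mixin Record isCStar (R : realType) A of CompleteNormedModule R[i] A := {
  cone : A;
  cmul : A -> A -> A;
  star : A -> A;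
  cmulA : associative cmul;
  cmul1x : left_id cone cmul;
  cmulx1 : right_id cone cmul;
  cmulDl : left_distributive cmul +%R;
  cmulDr : right_distributive cmul +%R;
  cmulZl : forall (k : R[i]) (x y : A), cmul (k *: x) y = k *: cmul x y;
  cmulZr : forall (k : R[i]) (x y : A), cmul x (k *: y) = k *: cmul x y;
  starK : involutive star;
  starD : {morph star : x y / x + y};
  starZ : forall (k : R[i]) (x : A), star (k *: x) = (k^*)%C *: star x;
  starM : forall x y : A, star (cmul x y) = cmul (star y) (star x);
  cnormM : forall x y : A, `|cmul x y| <= `|x| * `|y|;
  cnorm_star : forall x : A, `|cmul (star x) x| = `|x| ^+ 2
}.

#[short(type="cstarAlgType")]
HB.structure Definition CStar (R : realType) :=
  {A of isCStar R A & CompleteNormedModule R[i] A}.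

Arguments cone {R A} : rename.

Infix "**" := cmul (at level 40, left associativity) : ring_scope.

(* Unital *-homomorphisms (automatically norm-decreasing). *)
Definition star_morphism (R : realType) (A B : cstarAlgType R)
    (phi : A -> B) : Prop :=
  [/\ forall (k : R[i]) x y, phi (k *: x + y) = k *: phi x + phi y,
      phi cone = cone,
      forall x y, phi (x ** y) = phi x ** phi y &
      forall x, phi (star x) = star (phi x)].

Definition skew_symmetric (R : realType) n (theta : 'M[R]_n) : Prop :=
  theta^T = - theta.

Definition irrational_above_diag (R : realType) n (theta : 'M[R]_n) : Prop :=
  forall j k : 'I_n, (j < k)%N -> irrational (theta j k).

Definition Qfree_above_diag (R : realType) n (theta : 'M[R]_n) : Prop :=
  forall q : 'I_n -> 'I_n -> rat,
    \sum_(j < n) \sum_(k < n | (j < k)%N) ratr (q j k) * theta j k = 0 ->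
    forall j k : 'I_n, (j < k)%N -> q j k = 0.

Definition expi (R : realType) (x : R) : R[i] := cos x +i* sin x.

Definition unitary (R : realType) (A : cstarAlgType R) (u : A) : Prop :=
  star u ** u = cone /\ u ** star u = cone.

Definition torus_relations (R : realType) n (theta : 'M[R]_n)
    (A : cstarAlgType R) (U : 'I_n -> A) : Prop :=
  (forall k, unitary (U k)) /\
  (forall j k, U k ** U j = expi (2 * pi * theta j k) *: (U j ** U k)).

(* The closed *-subalgebra generated by the family U is the whole of A. *)
Definition generates (R : realType) n (A : cstarAlgType R) (U : 'I_n -> A) :
    Prop :=
  forall S : set A, closed S -> S cone ->
    (forall k, S (U k)) ->
    (forall x y, S x -> S y -> S (x + y)) ->
    (forall (c : R[i]) x, S x -> S (c *: x)) ->
    (forall x y, S x -> S y -> S (x ** y)) ->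
    (forall x, S x -> S (star x)) ->
    forall x, S x.

(* (A, U) is the universal C*-algebra A_theta with its generators.  Uniqueness
   of the morphism phi follows from [generates], since *-morphisms are
   continuous; (A, U) is thus determined up to a unique *-isomorphism. *)
Definition is_nc_torus (R : realType) n (theta : 'M[R]_n)
    (A : cstarAlgType R) (U : 'I_n -> A) : Prop :=
  [/\ torus_relations theta U,
      generates U &
      forall (B : cstarAlgType R) (V : 'I_n -> B), torus_relations theta V ->
        exists phi : A -> B,
          star_morphism phi /\ forall k, phi (U k) = V k].

(* Integer powers of a unitary, whose inverse is its adjoint. *)
Definition unitary_exp (R : realType) (A : cstarAlgType R) (u : A) (z : int) :
    A :=
  match z with Posz k => iter k (cmul u) cone | Negz k => iter k.+1 (cmul (star u)) cone end.

(* U^m = U_1^{m_1} ... U_n^{m_n}; the big operator multiplies in increasing order. *)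
Definition monomial (R : realType) n (A : cstarAlgType R) (U : 'I_n -> A)
    (m : 'rV[int]_n) : A :=
  \big[cmul/cone]_(j < n) unitary_exp (U j) (m 0 j).

(* The action of R^n on A_theta; each alpha s is a unital *-endomorphism,
   bijective by the group law. *)
Definition is_torus_action (R : realType) n (A : cstarAlgType R)
    (U : 'I_n -> A) (alpha : 'rV[R]_n -> A -> A) : Prop :=
  [/\ forall s, star_morphism (alpha s),
      forall x, alpha 0 x = x,
      forall s t x, alpha (s + t) x = alpha s (alpha t x) &
      forall s m, alpha s (monomial U m) =
        expi (\sum_(j < n) s 0 j * (m 0 j)%:~R) *: monomial U m].

(* g is the partial derivative of f with respect to the (real) variable j. *)
Definition is_partial (R : realType) n (E : normedModType R[i])
    (j : 'I_n) (f g : 'rV[R]_n -> E) : Prop :=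
  forall s : 'rV[R]_n,
    (h^-1)%:C *: (f (s + h *: delta_mx 0 j) - f s) @[h --> (0 : R)^'] --> g s.

Fixpoint class_C (R : realType) n (E : normedModType R[i]) (k : nat)
    (f : 'rV[R]_n -> E) : Prop :=
  continuous f /\
  match k with
  | 0 => True
  | k'.+1 => forall j, exists g, is_partial j f g /\ class_C k' g
  end.

Definition smooth_element (R : realType) n (A : cstarAlgType R)
    (alpha : 'rV[R]_n -> A -> A) (a : A) : Prop :=
  forall k, class_C k (fun s => alpha s a).

(* a = \sum_(m in Z^n) c_m U^m, as an unconditionally convergent sum in A
   (limit of the net of finite partial sums). *)
Definition fourier_expansion (R : realType) n (A : cstarAlgType R)
    (U : 'I_n -> A) (a : A) (c : 'rV[int]_n -> R[i]) : Prop :=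
  (fun F : {fset 'rV[int]_n} => \sum_(m <- F) c m *: monomial U m)
    @ totally --> a.

Definition sobolev_normsq (R : realType) n (s : R) (c : 'rV[int]_n -> R[i]) :
    \bar R :=
  \esum_(m in [set: 'rV[int]_n])
    ((1 + \sum_(j < n) (`|m 0 j|%:~R) ^+ 2) `^ s * Normc.normc (c m) ^+ 2)%:E.

(* ||a||_s = r, for a = \sum_m c_m U^m.  An element of A_theta^oo has exactly
   one such expansion, with rapidly decreasing coefficients, hence exactly one
   norm r for each s. *)
Definition is_sobolev_norm (R : realType) n (A : cstarAlgType R)
    (U : 'I_n -> A) (s : R) (a : A) (r : R) : Prop :=
  exists c : 'rV[int]_n -> R[i],
    [/\ fourier_expansion U a c, 0 <= r & sobolev_normsq s c = (r ^+ 2)%:E].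

(* (H, iota) is the completion of (A_theta^oo, ||.||_s): a complete normed space
   with a linear isometric embedding of A_theta^oo with dense image.  Only the
   values of iota on A_theta^oo matter. *)
Definition is_sobolev_space (R : realType) n (A : cstarAlgType R)
    (U : 'I_n -> A) (alpha : 'rV[R]_n -> A -> A) (s : R)
    (H : completeNormedModType R[i]) (iota : A -> H) : Prop :=
  [/\ forall (k : R[i]) a b, smooth_element alpha a -> smooth_element alpha b ->
        iota (k *: a + b) = k *: iota a + iota b,
      forall a r, smooth_element alpha a -> is_sobolev_norm U s a r ->
        `|iota a| = r%:C &
      closure (iota @` [set a | smooth_element alpha a]) = [set: H]].

(* Main.v *)
Require Import Defs.
From mathcomp Require Import all_boot all_order all_algebra.
From mathcomp Require Import finmap complex ring lra zify.
From mathcomp Require Import all_classical all_reals all_analysis.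
From mathcomp Require Import analysis.showcase.summability.

(** Rellich's compactness theorem for the Sobolev spaces of a noncommutative
torus.  In terms of Fourier coefficients the norm of order s is a weighted l^2
norm on Z^n, the weight at m being w(m)^s with w(m) = 1 + |m|^2, so the
multiplicative structure of the algebra plays no part.

For d bounded in the norm of order s and t < s, the part of the squared norm
of order t supported on w >= W is at most W^(t-s) times the squared norm of
order s, which is small for W large; the remaining part involves only the
finitely many m with w(m) < W ([finite_lattice_weight_lt]).  Hence the norm of
order t of d is small as soon as finitely many coefficients of d are small
([sobolev_normsq_small]).

Each coefficient of a_N is bounded uniformly in N.  In place of a diagonal
extraction, fix an ultrafilter F on the indices that refines the filter of
cofinite sets: along F every coefficient converges, so for any finite set of
coefficients there is a member of F on which these coefficients are pairwise
close ([ultra_coef_close]).  Applied to the differences a_N - a_M, whose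
norm of order t is the distance of their images in H^t
([sobolev_space_dist_le]), this shows that the images of the a_N are Cauchy
along F, hence converge along F by completeness.  A limit along a
proper filter that contains all cofinite sets is the limit of a subsequence
([subsequence_cvg]). *)

Set Implicit Arguments.
Unset Strict Implicit.
Unset Printing Implicit Defensive.

Import Order.TTheory GRing.Theory Num.Theory.
Import numFieldNormedType.Exports.

Local Open Scope classical_set_scope.
Local Open Scope ring_scope.
Local Open Scope complex_scope.

(** * Moduli of complex numbers and sums of nonnegative families *)

Lemma normc_sqr (R : rcfType) (z : R[i]) :
  Normc.normc z ^+ 2 = complex.Re z ^+ 2 + complex.Im z ^+ 2.
Proof. by case: z => x y /=; rewrite sqr_sqrtr// addr_ge0// sqr_ge0. Qed.

Lemma normc_sqrB_le (R : rcfType) (z w : R[i]) :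
  Normc.normc (z - w) ^+ 2 <= 2 * Normc.normc z ^+ 2 + 2 * Normc.normc w ^+ 2.
Proof.
rewrite !normc_sqr; case: z w => [x y] [x' y'] /=.
have := sqr_ge0 (x + x'); have := sqr_ge0 (y + y'); rewrite !expr2; lra.
Qed.

Lemma le_esum_fsetP (R : realType) (T : choiceType) (f : T -> R) (B : R) :
  (\esum_(i in [set: T]) (f i)%:E <= B%:E)%E <->
  forall D : {fset T}, \sum_(i <- D) f i <= B.
Proof.
have fsetE (D : {fset T}) :
    (\sum_(i \in [set` D]) (f i)%:E = (\sum_(i <- D) f i)%R%:E)%E.
  by rewrite fsbig_finite//= set_fsetK sumEFin.
split=> [le_fB D | le_fB].
  rewrite -lee_fin -fsetE; apply: le_trans le_fB.
  by apply: ereal_sup_ubound; exists [set` D].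
apply: ge_ereal_sup => _ [X [finX _] <-].
by rewrite -(fset_setK finX) fsetE lee_fin.
Qed.

Lemma sum_fset_mem_le (R : realType) (T : choiceType) (f : T -> R)
    (D E : {fset T}) : (forall i, 0 <= f i) ->
  \sum_(i <- E | i \in D) f i <= \sum_(i <- D) f i.
Proof.
move=> f_ge0; rewrite -big_filter.
have DE : perm_eq [seq i <- E | i \in D] [seq i <- D | i \in E].
  by apply: uniq_perm; rewrite ?filter_uniq// => i; rewrite !mem_filter andbC.
by rewrite (perm_big _ DE) big_filter big_mkcond ler_sum// => i _; case: ifP.
Qed.

(** * Limits along ultrafilters, and subsequences *)

Lemma ultra_bounded_cvg (R : realType) (T : Type) (F : set_system T)
    (u : T -> R) (M : R) : UltraFilter F -> (forall x, `|u x| <= M) ->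
  exists l : R, u @ F --> l.
Proof.
move=> FU u_le; have FF : ProperFilter F by apply: ultra_proper.
have uM : (u @ F) `[- M, M]%classic.
  by apply: (@filterE _ F) => x; rewrite /= in_itv /= -ler_norml.
have [l [_ clu]] := segment_compact _ uM.
exists l => V Vl; rewrite /fmap /=.
have [//|FC] := in_ultra_setVsetC (u @^-1` V) FU.
by have [y []] := clu (~` V) V FC Vl.
Qed.

(** For F finer than the Frechet filter, each neighbourhood of the limit along
    F contains terms of arbitrarily large index. *)
Lemma subsequence_cvg (R : realType) (V : normedModType R[i])
    (F : set_system nat) (x : nat -> V) (l : V) :
  ProperFilter F -> \oo `<=` F -> x @ F --> l ->
  exists phi : nat -> nat,
    {homo phi : i j / (i < j)%N} /\ x (phi j) @[j --> \oo] --> l.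
Proof.
move=> FF ooF xl.
(* From (k, p), choose an index beyond p whose term is 1/(k+1)-close to l. *)
have pick_ex (kp : nat * nat) : exists N, (kp.2 < N)%N /\
    `|l - x N| < (kp.1.+1%:R^-1 : R)%:C.
  have e_gt0 : 0 < (kp.1.+1%:R^-1 : R)%:C by rewrite ltcR invr_gt0.
  have Fx : F [set N | `|l - x N| < (kp.1.+1%:R^-1 : R)%:C].
    by move/cvgrPdist_lt: xl; apply.
  have Fgt : F [set N | (kp.2 < N)%N] by apply: ooF; exists kp.2.+1.
  by have [N []] := filter_ex (filterI Fx Fgt); exists N.
have [pick pickP] := choice pick_ex.
pose phi := fix phi k := if k is k'.+1 then pick (k, phi k') else pick (0, 0)%N.
exists phi; split.
  have phiS k : (phi k < phi k.+1)%N by have [] := pickP (k.+1, phi k).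
  exact: (homo_ltn (r := fun i j => (i < j)%N)
    (fun y i j => @ltn_trans y i j) phiS).
have phi_near k : `|l - x (phi k)| < (k.+1%:R^-1 : R)%:C.
  by case: k => [|k];
    [have [] := pickP (0, 0)%N | have [] := pickP (k.+1, phi k)].
apply/cvgrPdist_lt => -[e e'] /[!ltcE] /= /andP[/eqP -> e_gt0].
near=> k; apply: (lt_trans (phi_near k)).
rewrite ltcR; near: k.
have := @cvg_harmonic R => /cvgr0Pnorm_lt /(_ e e_gt0).
by apply: filterS => k; rewrite /= ger0_norm// invr_ge0.
Unshelve. all: by end_near. Qed.

(** A pointwise bounded family of coefficients is Cauchy along an ultrafilter,
    uniformly on each finite set of indices. *)
Lemma ultra_coef_close (R : realType) (I : choiceType) (T : Type)
    (F : set_system T) (c : T -> I -> R[i]) (B : I -> R) (D : {fset I})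
    (delta : R) :
  UltraFilter F -> (forall N i, Normc.normc (c N i) ^+ 2 <= B i) ->
  0 < delta ->
  exists S : set T, F S /\ forall N M, S N -> S M ->
    forall i, i \in D -> Normc.normc (c N i - c M i) ^+ 2 <= delta.
Proof.
move=> FU cB delta_gt0; have FF : ProperFilter F by apply: ultra_proper.
(* Real and imaginary parts within r of their limits differ pairwise by at
   most 2 r, and 8 r^2 <= 8 r <= delta because r <= 1. *)
pose r := Num.min 1 (delta / 8).
have r_gt0 : 0 < r by rewrite lt_min ltr01 divr_gt0.
have rr : 8 * r ^+ 2 <= delta.
  have r1 : r <= 1 by rewrite ge_min lexx.
  have rd : r <= delta / 8 by rewrite ge_min lexx orbT.
  have : r ^+ 2 <= r by rewrite expr2 ger_pMr.
  lra.
have near_limit (u : T -> R) M : (forall N, u N ^+ 2 <= M) ->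
    exists l, F [set N | `|l - u N| < r].
  move=> uM; have [N|l ul] := @ultra_bounded_cvg R T F u (Num.sqrt M) FU.
    by rewrite -sqrtr_sqr ler_wsqrtr.
  by exists l; move/cvgrPdist_lt: ul; apply.
have closei i : exists S : set T, F S /\ forall N M, S N -> S M ->
    Normc.normc (c N i - c M i) ^+ 2 <= delta.
  have [|lr Flr] := near_limit (fun N => complex.Re (c N i)) (B i).
    by move=> N; apply: le_trans (cB N i); rewrite normc_sqr lerDl sqr_ge0.
  have [|li Fli] := near_limit (fun N => complex.Im (c N i)) (B i).
    by move=> N; apply: le_trans (cB N i); rewrite normc_sqr lerDr sqr_ge0.
  exists ([set N | `|lr - complex.Re (c N i)| < r] `&`
          [set N | `|li - complex.Im (c N i)| < r]).
  split; first exact: filterI.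
  move=> N M [/= Nr Ni] [/= Mr Mi]; apply: le_trans rr.
  rewrite normc_sqr raddfB [complex.Im _]raddfB /=.
  move: Nr Ni Mr Mi; rewrite !ltr_norml.
  move=> /andP[? ?] /andP[? ?] /andP[? ?] /andP[? ?].
  have sq_le (x y l : R) : - r < l - x -> l - x < r -> - r < l - y ->
      l - y < r -> (x - y) ^+ 2 <= 4 * r ^+ 2.
    move=> *; have : 0 <= (2 * r - (x - y)) * (2 * r + (x - y)).
      by apply: mulr_ge0; lra.
    rewrite !expr2; lra.
  have -> : 8 * r ^+ 2 = 4 * r ^+ 2 + 4 * r ^+ 2 by ring.
  by rewrite lerD//; [exact: (sq_le _ _ lr)|exact: (sq_le _ _ li)].
have [S' SP] := choice closei.
exists (\bigcap_(i in [set` D]) S' i); split.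
  by apply: filter_bigI => i _; have [] := SP i.
by move=> N M SN SM i iD; have [_] := SP i; apply; [exact: SN|exact: SM].
Qed.

(** * Linear combinations of smooth elements and of Fourier expansions *)

Lemma is_partial_lincomb (R : realType) n (E : normedModType R[i]) (j : 'I_n)
    (z : R[i]) (f f' g g' : 'rV[R]_n -> E) :
  is_partial j f f' -> is_partial j g g' ->
  is_partial j (fun s => z *: f s + g s) (fun s => z *: f' s + g' s).
Proof.
move=> df dg s.
apply: cvg_trans (cvgD (cvgZl_tmp (k := z) (df s)) (dg s)).
apply: near_eq_cvg.
near=> h.
by rewrite !fctE /= opprD addrACA -scalerBr [RHS]scalerDr !scalerA [z * _]mulrC.
Unshelve. all: by end_near. Qed.

Lemma class_C_lincomb (R : realType) n (E : normedModType R[i]) (k : nat)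
    (z : R[i]) (f g : 'rV[R]_n -> E) :
  class_C k f -> class_C k g -> class_C k (fun s => z *: f s + g s).
Proof.
elim: k f g => [|k IHk] f g [cf df] [cg dg]; (split;
  first by move=> s; apply: cvgD (cvgZl_tmp (k := z) (cf s)) (cg s)) => //.
move=> j; have [f' [ff' Cf']] := df j; have [g' [gg' Cg']] := dg j.
exists (fun s => z *: f' s + g' s); split; first exact: is_partial_lincomb.
exact: IHk.
Qed.

Lemma smooth_element_lincomb (R : realType) n (A : cstarAlgType R)
    (alpha : 'rV[R]_n -> A -> A) (z : R[i]) (a b : A) :
  (forall s, star_morphism (alpha s)) ->
  smooth_element alpha a -> smooth_element alpha b ->
  smooth_element alpha (z *: a + b).
Proof.
move=> alphaM sa sb k.
suff -> : (fun s => alpha s (z *: a + b)) =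
    (fun s => z *: alpha s a + alpha s b) by apply: class_C_lincomb.
by apply/funext => s; have [-> _ _ _] := alphaM s.
Qed.

Lemma fourier_expansionB (R : realType) n (A : cstarAlgType R) (U : 'I_n -> A)
    (a b : A) (c d : 'rV[int]_n -> R[i]) :
  fourier_expansion U a c -> fourier_expansion U b d ->
  fourier_expansion U (a - b) (fun m => c m - d m).
Proof.
move=> ac bd.
have totF : ProperFilter (@totally 'rV[int]_n) := totally_filter.
apply: cvg_trans (cvgB ac bd); apply: near_eq_cvg; near=> F.
rewrite !fctE -sumrB; apply: eq_bigr => m _; exact: esym (scalerBl _ _ _).
Unshelve. all: by end_near. Qed.

(** * Weighted l^2 norms on Z^n *)

(** The base 1 + |m|^2 of the Sobolev weights. *)
Definition lattice_weight (R : realType) n (m : 'rV[int]_n) : R :=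
  1 + \sum_(j < n) (`|m 0 j|%:~R) ^+ 2.

Arguments lattice_weight R {n} m.

Lemma lattice_weight_ge1 (R : realType) n (m : 'rV[int]_n) :
  1 <= lattice_weight R m.
Proof. by rewrite lerDl sumr_ge0// => j _; rewrite sqr_ge0. Qed.

Lemma finite_lattice_weight_lt (R : realType) n (W : R) :
  finite_set [set m : 'rV[int]_n | lattice_weight R m < W].
Proof.
have [K WK] : exists K : nat, W < K%:R.
  by exists (Num.bound `|W|); apply: le_lt_trans (ler_norm W) (archi_boundP _).
(* A lattice point of weight below K has all its coordinates in [-K, K]. *)
pose g (f : {ffun 'I_n -> 'I_(K + K).+1}) : 'rV[int]_n :=
  \row_j ((f j : nat)%:Z - K%:Z).
apply: (@sub_finite_set _ _ (range g)); last first.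
  by apply: finite_image; apply: finite_finset.
move=> m /= mW.
have mK j : (`|m 0%R j| <= K)%N.
  rewrite leqNgt; apply/negP => Kj.
  have: K%:R < lattice_weight R m.
    rewrite /lattice_weight (bigD1 j)//= ltr_wpDl//.
    rewrite ltr_wpDr//; first by rewrite sumr_ge0// => i _; rewrite sqr_ge0.
    rewrite -abszE -pmulrn -natrX ltr_nat.
    by rewrite -mulnn (leq_trans Kj)// leq_pmulr// (leq_ltn_trans _ Kj).
  by move=> /lt_trans /(_ mW) /lt_trans /(_ WK); rewrite ltxx.
exists [ffun j => inord (absz (m 0 j + K%:Z)%R)] => //.
apply/rowP => j; rewrite !mxE ffunE; have := mK j => mKj.
rewrite inordK; first by lia.
lia.
Qed.

Lemma sobolev_normsq_leP (R : realType) n (s : R) (c : 'rV[int]_n -> R[i])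
    (B : R) :
  (sobolev_normsq s c <= B%:E)%E <->
  forall D : {fset 'rV[int]_n},
    \sum_(m <- D) (lattice_weight R m `^ s * Normc.normc (c m) ^+ 2) <= B.
Proof. exact: le_esum_fsetP. Qed.

Lemma sobolev_normsq_ge0 (R : realType) n (s : R) (c : 'rV[int]_n -> R[i]) :
  (0 <= sobolev_normsq s c)%E.
Proof.
by apply: esum_ge0 => m _; rewrite lee_fin mulr_ge0// ?powR_ge0// sqr_ge0.
Qed.

Lemma sobolev_normsqB_le (R : realType) n (s : R) (c d : 'rV[int]_n -> R[i])
    (B : R) :
  (sobolev_normsq s c <= B%:E)%E -> (sobolev_normsq s d <= B%:E)%E ->
  (sobolev_normsq s (fun m => (c m - d m)%R) <= (4 * B)%:E)%E.
Proof.
move=> /sobolev_normsq_leP cB /sobolev_normsq_leP dB.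
apply/sobolev_normsq_leP => D.
have : \sum_(m <- D) (lattice_weight R m `^ s * Normc.normc (c m - d m) ^+ 2) <=
    \sum_(m <- D) (2 * (lattice_weight R m `^ s * Normc.normc (c m) ^+ 2) +
                   2 * (lattice_weight R m `^ s * Normc.normc (d m) ^+ 2)).
  apply: ler_sum => m _.
  have := ler_wpM2l (powR_ge0 (lattice_weight R m) s)
    (normc_sqrB_le (c m) (d m)).
  by rewrite mulrDr ![_ `^ s * (2 * _)]mulrCA.
rewrite big_split/= -!mulr_sumr; have := cB D; have := dB D; lra.
Qed.

Lemma sobolev_coef_le (R : realType) n (s : R) (c : 'rV[int]_n -> R[i])
    (B : R) (m : 'rV[int]_n) :
  (sobolev_normsq s c <= B%:E)%E ->
  Normc.normc (c m) ^+ 2 <= B / lattice_weight R m `^ s.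
Proof.
move=> /sobolev_normsq_leP /(_ [fset m]%fset); rewrite big_seq_fset1.
rewrite ler_pdivlMr 1?mulrC// powR_gt0//.
exact: lt_le_trans (lattice_weight_ge1 _ _).
Qed.

(** On sets bounded in the norm of order s, the norm of order t < s is
    controlled by finitely many coefficients. *)
Lemma sobolev_normsq_small (R : realType) n (s t B e : R) :
  t < s -> 0 < e ->
  exists (D : {fset 'rV[int]_n}) (delta : R), 0 < delta /\
    forall d : 'rV[int]_n -> R[i],
      (sobolev_normsq s d <= B%:E)%E ->
      (forall m, m \in D -> Normc.normc (d m) ^+ 2 <= delta) ->
      (sobolev_normsq t d <= e%:E)%E.
Proof.
move=> lt_ts e_gt0; pose w (m : 'rV[int]_n) := lattice_weight R m.
have w_gt0 m : 0 < w m by apply: lt_le_trans (lattice_weight_ge1 _ _).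
pose p := s - t; have p_gt0 : 0 < p by rewrite subr_gt0.
(* B1 is a positive bound replacing B, and W is chosen so that
   W^(t-s) * B1 = e / 2. *)
pose B1 := `|B| + 1; have B1_gt0 : 0 < B1 by rewrite ltr_wpDl.
pose W := (2 * B1 / e) `^ p^-1.
have W_gt0 : 0 < W by rewrite powR_gt0// divr_gt0// mulr_gt0.
have Wp : W `^ p = 2 * B1 / e.
  rewrite -powRrM mulVf ?lt0r_neq0// powRr1//.
  by rewrite ltW// divr_gt0// mulr_gt0.
pose D := fset_set [set m | w m < W].
have memD m : (m \in D) = (w m < W).
  rewrite in_fset_set; last exact: finite_lattice_weight_lt.
  by apply/idP/idP => [/set_mem|?]; last exact/mem_set.
(* The summand 1 keeps Sg positive when D is empty. *)
pose Sg := 1 + \sum_(m <- D) w m `^ t.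
have Sg_gt0 : 0 < Sg by rewrite ltr_pwDl// sumr_ge0// => m _; exact: powR_ge0.
exists D, (e / 2 / Sg); split; first by rewrite !divr_gt0.
move=> d /sobolev_normsq_leP dB d_small; apply/sobolev_normsq_leP => E.
pose x m := Normc.normc (d m) ^+ 2.
have x_ge0 m : 0 <= x m by exact: sqr_ge0.
rewrite (bigID (mem D))/= -/w -/x (splitr e) lerD//.
  apply: (@le_trans _ _ (\sum_(m <- E | m \in D) (w m `^ t * (e / 2 / Sg)))).
    by apply: ler_sum => m mD; rewrite ler_wpM2l ?powR_ge0// d_small.
  rewrite -mulr_suml mulrCA ger_pMr ?divr_gt0// ler_pdivrMr// mul1r.
  rewrite /Sg ler_wpDl//; apply: sum_fset_mem_le => m; exact: powR_ge0.
apply: (@le_trans _ _ (\sum_(m <- E | m \notin D) ((w m `^ s * x m) / W `^ p))).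
  apply: ler_sum => m; rewrite memD -leNgt => Ww.
  rewrite [leRHS]mulrAC ler_wpM2r ?sqr_ge0// -/(w m).
  rewrite ler_pdivlMr 1?powR_gt0//.
  (* w^t <= w^s / W^p because w^s = w^t * w^p and W <= w. *)
  have -> : w m `^ s = w m `^ t * w m `^ p.
    by rewrite -powRD ?lt0r_neq0 ?implybT// /p addrC subrK.
  rewrite ler_wpM2l ?powR_ge0// ge0_ler_powR// ?nnegrE ?ltW//.
rewrite -mulr_suml Wp ler_pdivrMr ?divr_gt0 ?mulr_gt0//.
have -> : e / 2 * (2 * B1 / e) = B1 by field; rewrite lt0r_neq0.
apply: (@le_trans _ _ (\sum_(m <- E) w m `^ s * x m)).
  rewrite [leRHS](bigID (mem D))/= lerDr sumr_ge0// => m _.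
  by rewrite mulr_ge0 ?powR_ge0.
by apply: (le_trans (dB E)); rewrite (le_trans (ler_norm B))// lerDl.
Qed.

(** * Compactness *)

(** The embedding of the smooth elements is isometric for the distance
    computed on Fourier coefficients. *)
Lemma sobolev_space_dist_le (R : realType) n (A : cstarAlgType R)
    (U : 'I_n -> A) (alpha : 'rV[R]_n -> A -> A) (t : R)
    (H : completeNormedModType R[i]) (iota : A -> H) (a b : A)
    (c d : 'rV[int]_n -> R[i]) (e : R) :
  (forall s, star_morphism (alpha s)) -> is_sobolev_space U alpha t iota ->
  smooth_element alpha a -> smooth_element alpha b ->
  fourier_expansion U a c -> fourier_expansion U b d -> 0 <= e ->
  (sobolev_normsq t (fun m => (c m - d m)%R) <= (e ^+ 2)%:E)%E ->
  `|iota a - iota b| <= e%:C.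
Proof.
move=> alphaM [iotaL iotaN _] sa sb ac bd e_ge0 cd_le.
have sab : smooth_element alpha (a - b).
  by rewrite addrC -scaleN1r; apply: smooth_element_lincomb.
have <- : iota (a - b) = iota a - iota b.
  by rewrite addrC -scaleN1r iotaL// scaleN1r addrC.
set q := sobolev_normsq _ _ in cd_le.
have q_ge0 : (0 <= q)%E by exact: sobolev_normsq_ge0.
have q_fin : q \is a fin_num
  by rewrite ge0_fin_numE// (le_lt_trans cd_le)// ltry.
have fq_ge0 : 0 <= fine q by exact: fine_ge0.
rewrite (iotaN (a - b) (Num.sqrt (fine q)))//; last first.
  exists (fun m => c m - d m); split.
  - exact: fourier_expansionB.
  - exact: sqrtr_ge0.
  - by rewrite sqr_sqrtr// fineK.
rewrite lecR -(ger0_norm e_ge0) -sqrtr_sqr ler_wsqrtr//.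
by rewrite -lee_fin fineK.
Qed.

Theorem theorem1p4 (R : realType) (n : nat) (theta : 'M[R]_n)
  (A : cstarAlgType R) (U : 'I_n -> A)
  (alpha : 'rV[R]_n -> A -> A)
  (s t : R) (Ht : completeNormedModType R[i]) (iota : A -> Ht)
  (a : nat -> A) (C : R)
  (n_gt0 : (0 < n)%N)
  (theta_skew : skew_symmetric theta)
  (theta_irr : irrational_above_diag theta)
  (theta_free : Qfree_above_diag theta)
  (A_torus : is_nc_torus theta U)
  (alpha_action : is_torus_action U alpha)
  (Ht_sobolev : is_sobolev_space U alpha t iota)
  (lt_ts : t < s)
  (a_smooth : forall N, smooth_element alpha (a N))
  (a_bounded : forall N, exists r : R, is_sobolev_norm U s (a N) r /\ r <= C) :
  exists phi : nat -> nat,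
    {homo phi : i j / (i < j)%N} /\
    exists l : Ht, iota (a (phi j)) @[j --> \oo] --> l.
Proof.
have [alphaM _ _ _] := alpha_action.
have coef_ex N : exists c : 'rV[int]_n -> R[i],
    fourier_expansion U (a N) c /\ (sobolev_normsq s c <= (C ^+ 2)%:E)%E.
  have [r [[c [ac r_ge0 cE]] rC]] := a_bounded N.
  by exists c; split=> //; rewrite cE lee_fin lerXn2r// nnegrE (le_trans r_ge0).
have [c cP] := choice coef_ex.
have [F [FU ooF]] := ultraFilterLemma (@eventually_filter).
have FF : ProperFilter F by apply: ultra_proper.
pose x N := iota (a N).
(* The bound 4 C^2 holds for the squared norm of order s of differences. *)
have x_cauchy : cauchy (x @ F).
  apply: cauchy_exP => -[e e'] /[!ltcE] /= /andP[/eqP -> e_gt0].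
  have [D [delta [delta_gt0 small]]] :=
    @sobolev_normsq_small R n s t (4 * C ^+ 2) ((e / 2) ^+ 2) lt_ts
      ltac:(by rewrite exprn_gt0// divr_gt0).
  have [S [FS close]] := @ultra_coef_close R _ _ F c
    (fun m => C ^+ 2 / lattice_weight R m `^ s) D delta FU
    (fun N m => sobolev_coef_le m (cP N).2) delta_gt0.
  have [M SM] := filter_ex FS.
  exists (x M); apply: filterS FS => N SN; rewrite -ball_normE /=.
  apply: (@le_lt_trans _ _ (e / 2)%:C); last by rewrite ltcR; lra.
  apply: (sobolev_space_dist_le alphaM Ht_sobolev (a_smooth M) (a_smooth N)
    (cP M).1 (cP N).1); first by rewrite ltW// divr_gt0.
  apply: small; first exact: sobolev_normsqB_le (cP M).2 (cP N).2.
  by move=> m mD; apply: close.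
have x_cvg : cvg (x @ F) by exact: cauchy_cvg.
have [phi [phi_incr phi_l]] := subsequence_cvg FF ooF x_cvg.
by exists phi; split=> //; exists (lim (x @ F)).
Qed.
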